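(* Let $p,q$ be distinct primes with $q$ odd, and let $G$ be a finite abelian group containing a proper subgroup isomorphic to $\mathbb{Z}_{p^2}\times\mathbb{Z}_{p^2}$ or to $\mathbb{Z}_{p^2q^2}$. If $G$ is not isomorphic to one of the groups $$\mathbb{Z}_{p^2}^2\times\mathbb{Z}_2,\quad \mathbb{Z}_{2p^2}\times\mathbb{Z}_{p^2},\quad \mathbb{Z}_9^2\times\mathbb{Z}_3,\quad \mathbb{Z}_4^2\times\mathbb{Z}_2^2,\quad \mathbb{Z}_{4q^2}\times\mathbb{Z}_2,$$ then $G$ does not have the PT property.
   Context: $\mathbb{Z}_N$ denotes the cyclic group of order $N$. For a finite abelian group $G$ (written additively), a pair $(\Omega,T)$ of subsets of $G$ is a tiling pair if every $g\in G$ can be written uniquely as $g=\omega+t$ with $\omega\in\Omega$, $t\in T$. A nonempty subset $A\subset G$ is periodic if there is a nonzero $g\in G$ with $A+g=A$. $G$ has the periodic tiling property (PT property) if for every tiling pair $(\Omega,T)$ of $G$, either $\Omega$ is periodic, or there is a periodic set $T'\subset G$ such that $(\Omega,T')$ is also a tiling pair. *)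

(* Defs.v *)
From HB Require Import structures.
From mathcomp Require Import all_boot all_order all_fingroup all_algebra.

Set Implicit Arguments.
Unset Strict Implicit.
Unset Printing Implicit Defensive.

Import GRing.Theory.
Local Open Scope ring_scope.

Definition tiling_pair (G : finZmodType) (Omega T : {set G}) : Prop :=
  forall g : G, exists! wt : G * G,
    [/\ wt.1 \in Omega, wt.2 \in T & g = wt.1 + wt.2].

Definition periodic (G : finZmodType) (A : {set G}) : Prop :=
  A != set0 /\ exists2 g : G, g != 0 & [set a + g | a in A] = A.

Definition PT_property (G : finZmodType) : Prop :=
  forall Omega T : {set G}, tiling_pair Omega T ->
    periodic Omega \/
    exists2 T' : {set G}, periodic T' & tiling_pair Omega T'.

(* For G : finZmodType, [set: G] is a group for addition: the library makes
   every finZmodType a finGroupType with x * y := x + y. *)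
Definition has_proper_subgroup_isog (G : finZmodType) (hT : finGroupType)
    (H : {set hT}) : Prop :=
  exists2 K : {group G}, K \proper [set: G] & K \isog H.

(* Main.v *)
(** Write K for the given subgroup; K = <a> + <b> with a, b independent of
    orders m^2 and n^2, where (m, n) is (p, p) or (p, q).  With
    T = {i a + j b | i < m, j < n}, R1 = <m a>, R2 = <n b> and P = R1 + R2,
    the pair (P, T) tiles K.  Since R1 + T is invariant under a, the set
    A1 = (P minus R1) union (R1 + a) still tiles K with T, and so does
    A2 = (P minus R2) union (R2 + b).  Put A1 on one coset of K, A2 on another one
    and P on all others: the union Omega tiles G with T.  A period of Omega of
    prime order has to lie in R1 and in R2, so Omega is not periodic.  The
    pieces are positioned in such a way that every element of prime order of
    G is a difference of two elements of Omega, which forbids any periodic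
    complement.

    The only elements that may fail to be such differences are the order 2
    elements of P outside R1 and R2, when K has index 2 and m = n = 2; then G
    is Z_8 x Z_4 or Z_4 x Z_4 x Z_2. *)

Require Import Defs.
From HB Require Import structures.
From mathcomp Require Import all_boot all_order all_fingroup all_algebra.
From mathcomp Require Import cyclic.

Set Implicit Arguments.
Unset Strict Implicit.
Unset Printing Implicit Defensive.

Import GRing.Theory FinRing.Theory.
Local Open Scope ring_scope.

(** * Subgroup membership in additive notation *)

Lemma mem0_group (G : finZmodType) (H : {group G}) : 0 \in H.
Proof. exact: group1. Qed.

Lemma memD_group (G : finZmodType) (H : {group G}) (x y : G) :
  x \in H -> y \in H -> x + y \in H.
Proof. exact: groupM. Qed.

Lemma memN_group (G : finZmodType) (H : {group G}) (x : G) :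
  (- x \in H) = (x \in H).
Proof. exact: groupV. Qed.

Lemma memB_group (G : finZmodType) (H : {group G}) (x y : G) :
  x \in H -> y \in H -> x - y \in H.
Proof. by move=> Hx Hy; rewrite memD_group ?memN_group. Qed.

Lemma memDl_group (G : finZmodType) (H : {group G}) (x y : G) :
  x \in H -> (y + x \in H) = (y \in H).
Proof. exact: groupMr. Qed.

Lemma memDr_group (G : finZmodType) (H : {group G}) (x y : G) :
  x \in H -> (x + y \in H) = (y \in H).
Proof. exact: groupMl. Qed.

Lemma memBC_group (G : finZmodType) (H : {group G}) (x y : G) :
  (x - y \in H) = (y - x \in H).
Proof. by rewrite -memN_group opprB. Qed.

Lemma memMn_group (G : finZmodType) (H : {group G}) (x : G) n :
  x \in H -> x *+ n \in H.
Proof. by move=> Hx; rewrite -zmodXgE; apply: groupX. Qed.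

(** By Bezout, x is an integer combination of m x and n x. *)
Lemma memMn_coprime (G : finZmodType) (H : {group G}) (x : G) m n :
  (0 < m)%N -> coprime m n -> x *+ m \in H -> x *+ n \in H -> x \in H.
Proof.
move=> m0; rewrite /coprime => /eqP co xm xn.
case: (egcdnP n m0) => u v E _.
have -> : x = x *+ m *+ u - x *+ n *+ v.
  by rewrite -!mulrnA (mulnC m) E co mulrnDr mulr1n (mulnC n) addrC addKr.
by apply: memB_group; apply: memMn_group.
Qed.

(** * Elements of prime order, periods, and the obstruction to periodic complements *)

Lemma mulrn_order (G : finZmodType) (x : G) : x *+ #[x]%g = 0.
Proof. by rewrite -zmodXgE expg_order. Qed.

Lemma prime_order_neq0 (G : finZmodType) (x : G) : prime #[x]%g -> x != 0.
Proof. by apply: contraL => /eqP ->; rewrite -[0]zmod1gE order1. Qed.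

Lemma order_prime (G : finZmodType) (x : G) r :
  prime r -> x != 0 -> x *+ r = 0 -> #[x]%g = r.
Proof.
move=> r_pr x0 xr; have : (#[x]%g %| r)%N by rewrite order_dvdn zmodXgE xr.
case/primeP: r_pr => _ /[apply] /orP[|/eqP//].
by rewrite order_eq1 => /eqP x1; rewrite x1 eqxx in x0.
Qed.

Lemma prime_multiple (G : finZmodType) (d : G) :
  d != 0 -> exists k, prime #[d *+ k]%g.
Proof.
move=> d0; have gt1 : (1 < #[d]%g)%N by rewrite order_gt1.
exists (#[d]%g %/ pdiv #[d]%g)%N; have pr := pdiv_prime gt1.
rewrite (@order_prime _ _ (pdiv #[d]%g)) //.
- apply/eqP => /eqP; rewrite -zmodXgE -order_dvdn.
  move/dvdn_leq; rewrite divn_gt0 ?prime_gt0 // pdiv_leq // => /(_ isT).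
  by rewrite leqNgt ltn_Pdiv // prime_gt1.
- by rewrite -mulrnA divnK ?pdiv_dvd // mulrn_order.
Qed.

Lemma period_mulrn (G : finZmodType) (A : {set G}) (g : G) k :
  [set a + g | a in A] = A -> forall a, (a + g *+ k \in A) = (a \in A).
Proof.
move=> Ag.
have step a : (a + g \in A) = (a \in A).
  by rewrite -{1}Ag (mem_imset _ _ (addIr g)).
elim: k => [|k IH] a; first by rewrite mulr0n addr0.
by rewrite mulrSr addrA step IH.
Qed.

(** Multiples of a period again leave the set invariant, and some multiple has prime order; so only
    elements of prime order have to be tested. *)
Lemma periodic_prime (G : finZmodType) (A : {set G}) : periodic A ->
  exists2 h : G, prime #[h]%g & forall a, (a + h \in A) = (a \in A).
Proof.
case=> _ [g g0 Ag]; have [k pr] := prime_multiple g0.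
by exists (g *+ k) => //; apply: period_mulrn.
Qed.

(** If a period h of a complement T' equals x - y with x, y in Omega, then x + t = y + (t + h)
    decomposes one element in two ways. *)
Lemma not_PT_property (G : finZmodType) (Omega T : {set G}) :
  tiling_pair Omega T -> ~ periodic Omega ->
  (forall h : G, prime #[h]%g ->
     exists x y, [/\ x \in Omega, y \in Omega & h = x - y]) ->
  ~ PT_property G.
Proof.
move=> tile aper diff /(_ _ _ tile)[//|[T' perT' tile']].
have /set0Pn[t tT'] := perT'.1.
have [h h_pr hT'] := periodic_prime perT'.
have [x [y [xO yO hE]]] := diff h h_pr.
have [wt [_ uniq]] := tile' (x + t).
have E1 := uniq (x, t); have E2 := uniq (y, t + h).
have := etrans (esym (E1 _)) (E2 _); move/(_ _ _)/(congr1 fst) => /=.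
move=> xy; move: (prime_order_neq0 h_pr); rewrite hE xy ?subrr ?eqxx //.
by split=> //=; rewrite ?hT' // hE addrCA [y + _]addrC subrK addrC.
Qed.

(** * Tilings of a subgroup and their assembly over its cosets *)

(** The version of [tiling_pair] relative to K. Uniqueness is asked of the first summand only; the
    second follows by cancellation. *)
Definition tiles (G : finZmodType) (A T K : {set G}) :=
  [/\ forall x t, x \in A -> t \in T -> x + t \in K,
      forall k, k \in K -> exists x t, [/\ x \in A, t \in T & k = x + t]
    & forall x t x' t', x \in A -> t \in T -> x' \in A -> t' \in T ->
        x + t = x' + t' -> x = x'].

(** The last two hypotheses say that R + T is invariant under translation by a, so R + a covers with
    T exactly what R covered. *)
Lemma tiles_switch (G : finZmodType) (K P R : {group G}) (T : {set G}) (a : G) :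
  tiles P T K -> R \subset P -> a \in K ->
  (forall t, t \in T -> exists r t', [/\ r \in R, t' \in T & a + t = r + t']) ->
  (forall t, t \in T -> exists r t', [/\ r \in R, t' \in T & t = a + (r + t')]) ->
  tiles [set x | (x \in P) && (x \notin R) || (x - a \in R)] T K.
Proof.
move=> [PTK KPT uni] /subsetP RP aK fwd bwd; split.
- move=> x t; rewrite inE => /orP[/andP[xP _]|xR] tT; first exact: PTK.
  by rewrite -(subrK a x) addrAC memD_group // PTK // RP.
- move=> k /KPT[x [t [xP tT ->]]].
  have [xR|xR] := boolP (x \in R); last by exists x, t; rewrite inE xP xR.
  have [r [t' [rR t'T ->]]] := bwd t tT.
  exists (x + r + a), t'; rewrite inE addrK memD_group ?orbT //; split=> //.
  by rewrite !addrA (addrAC x a r).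
(* A sum starting in R + a never meets one starting in P minus R: rewriting a + t as r + t1 would
   put x' in R. *)
- have mix x t x' t' : x - a \in R -> t \in T -> x' \in P -> x' \notin R ->
      t' \in T -> x + t = x' + t' -> x = x'.
    move=> xR tT x'P x'R t'T E; have [r [t1 [rR t1T E1]]] := fwd t tT.
    have xrR : x - a + r \in R by exact: memD_group.
    have xE : x - a + r = x'.
      by apply: (uni _ t1 _ t' (RP _ xrR)) => //; rewrite -E -addrA -E1 addrA subrK.
    by rewrite -xE xrR in x'R.
  move=> x t x' t'; rewrite !inE => /orP[/andP[xP xR]|xR] tT.
    case/orP=> [/andP[x'P _]|x'R] t'T E; first exact: uni E.
    by apply/esym; apply: mix (esym E).
  case/orP=> [/andP[x'P x'R]|x'R] t'T E; first exact: mix E.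
  apply: (addIr (- a)); apply: (uni _ t _ t'); rewrite ?RP //.
  by rewrite !(addrAC _ (- a)) E.
Qed.

(* The last clause makes [h] differ by an element of P from its
   representative, so that it is a difference of points of two translates of P. *)
Lemma coset_selector (G : finZmodType) (K P : {group G}) :
  (forall x, x \in K -> prime #[x]%g -> x \in P) ->
  exists f : G -> G, [/\ forall x, x \in K -> f x = 0,
    forall x, x - f x \in K, forall x y, x - y \in K -> f x = f y
    & forall h, prime #[h]%g -> h \notin K -> h - f h \in P].
Proof.
move=> KP.
pose f x := if x \in K then 0 else
  if [pick y | (x - y \in K) && prime #[y]%g] is Some y then y
  else odflt x [pick y | x - y \in K].
have f0 x : x \in K -> f x = 0 by rewrite /f => ->.
have fK x : x - f x \in K.
  rewrite /f; case: ifP => [|_]; first by rewrite subr0.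
  case: pickP => [y /andP[]//|_]; case: pickP => //= _; rewrite subrr.
  exact: mem0_group.
exists f; split=> // [x y xy|h h_pr hK].
- rewrite /f -(subrK y x) memDr_group //; case: ifP => // yK.
  have E z : (x - y + y - z \in K) = (y - z \in K).
    by rewrite -addrA memDr_group.
  have -> : [pick z | (x - y + y - z \in K) && prime #[z]%g] =
      [pick z | (y - z \in K) && prime #[z]%g].
    by apply: eq_pick => z /=; rewrite E.
  rewrite (eq_pick (E : _ =1 _)).
  case: pickP => // _; case: pickP => //= /(_ y).
  by rewrite subrr mem0_group.
- have := fK h; rewrite /f (negbTE hK).
  case: pickP => [y /andP[hyK y_pr] _|/(_ h)]; last first.
    by rewrite subrr mem0_group h_pr.
  have [->|hy] := eqVneq h y; first by rewrite subrr mem0_group.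
  (* If h and y have the same prime order, so has h - y, which therefore lies in P. If the orders
     differ, h has two coprime multiples in K, hence h is in K, a contradiction. *)
  have [rE|/eqP rN] := #[h]%g =P #[y]%g.
    apply: KP => //; rewrite (@order_prime _ _ #[h]%g) // ?subr_eq0 //.
    by rewrite mulrnBl {2}rE !mulrn_order subrr.
  case/negP: hK; apply: (@memMn_coprime _ _ _ #[h]%g #[y]%g) => //.
  - by rewrite prime_coprime // dvdn_prime2 //; apply/eqP.
  - by rewrite mulrn_order mem0_group.
  - by rewrite -(subr0 (h *+ _)) -(mulrn_order y) -mulrnBl memMn_group.
Qed.

(* [f] picks a representative of each coset of K, and [A c] is the piece of the
   tile placed on the coset represented by [c]. *)
Lemma tiling_pair_cosets (G : finZmodType) (K : {group G}) (T : {set G})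
    (f : G -> G) (A : G -> {set G}) :
  (forall x, x - f x \in K) -> (forall x y, x - y \in K -> f x = f y) ->
  T \subset K -> (forall c, tiles (A c) T K) ->
  tiling_pair [set y | y - f y \in A (f y)] T.
Proof.
move=> fK fE /subsetP TK tA g.
(* Adding an element of T stays in the same coset of K, so tiling can be checked coset by coset. *)
have fT y t : t \in T -> f (y + t) = f y.
  by move=> tT; apply: fE; rewrite addrAC subrr add0r TK.
have [_ exA uniA] := tA (f g); have [x [t [xA tT gE]]] := exA _ (fK g).
have fx : f (x + f g) = f g.
  by rewrite -(fT _ t) // addrAC -gE subrK.
exists (x + f g, t); split=> /= [|[w s] /= [wO sT gE']].
  by split; rewrite ?inE ?fx ?addrK // addrAC -gE subrK.
have fw : f w = f g by rewrite gE' fT.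
have xw : x = w - f g.
  by apply: (uniA _ t _ s) => //; rewrite ?inE ?fw in wO *; rewrite // -gE addrAC -gE'.
have wE : w = x + f g by rewrite xw subrK.
rewrite -wE; congr pair; apply: (addrI w); rewrite -gE'.
by rewrite wE addrAC -gE subrK.
Qed.

(** The last hypothesis asks for a third coset, one that carries P unchanged. It is needed only for
    the elements h of order 2 outside R1 and R2, because the other such h are obtained as 2 h - h
    with 2 h nonzero. *)
Lemma not_PT_property_switch (G : finZmodType) (K P R1 R2 : {group G})
    (T : {set G}) (a b g r1 r2 : G) :
  T \subset K -> tiles P T K ->
  (forall x, x \in K -> prime #[x]%g -> x \in P) ->
  R1 \subset P -> R2 \subset P ->
  (forall x, x \in P -> exists u v, [/\ u \in R1, v \in R2 & x = u + v]) ->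
  (forall x, x \in R1 -> x \in R2 -> x = 0) ->
  r1 \in R1 -> r1 != 0 -> r2 \in R2 -> r2 != 0 ->
  a \in K -> a \notin P -> b \in K -> b \notin P ->
  (forall t, t \in T -> exists r t', [/\ r \in R1, t' \in T & a + t = r + t']) ->
  (forall t, t \in T -> exists r t', [/\ r \in R1, t' \in T & t = a + (r + t')]) ->
  (forall t, t \in T -> exists r t', [/\ r \in R2, t' \in T & b + t = r + t']) ->
  (forall t, t \in T -> exists r t', [/\ r \in R2, t' \in T & t = b + (r + t')]) ->
  g \notin K ->
  (forall h, h \in P -> #[h]%g = 2 -> h \notin R1 -> h \notin R2 ->
     exists2 g', g' \notin K & g' - g \notin K) ->
  ~ PT_property G.
Proof.
move=> TK tP KP R1P R2P span triv r1R r10 r2R r20 aK aP bK bP fa ba fb bb gK third.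
have r1P : r1 \in P := subsetP R1P _ r1R; have r2P : r2 \in P := subsetP R2P _ r2R.
have [f [f0 fK fE fP]] := coset_selector KP.
pose A1 := [set x | (x \in P) && (x \notin R1) || (x - a \in R1)].
pose A2 := [set x | (x \in P) && (x \notin R2) || (x - b \in R2)].
pose A c := if c == 0 then A1 else if c == f g then A2 else P : {set G}.
have tA1 : tiles A1 T K by apply: tiles_switch.
have tA2 : tiles A2 T K by apply: tiles_switch.
have tA c : tiles (A c) T K by rewrite /A; case: ifP => // _; case: ifP.
pose O := [set y | y - f y \in A (f y)].
have PK x : x \in P -> x \in K.
  have [PTK KPT _] := tP; have [y [t [_ tT _]]] := KPT 0 (mem0_group _).
  by move=> xP; rewrite -(memDl_group _ (subsetP TK _ tT)) PTK.
have fgK : f g \notin K.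
  by apply: contra gK => fgK; rewrite -(subrK (f g) g) memD_group.
have fg0 : (f g == 0) = false.
  by apply: contraNF fgK => /eqP ->; rewrite mem0_group.
have O_K y : y \in K -> (y \in O) = (y \in A1).
  by move=> yK; rewrite inE f0 // subr0 /A eqxx.
have O_g y : y - f g \in K -> (y \in O) = (y - f g \in A2).
  have ffg : f (f g) = f g by apply: fE; rewrite memBC_group.
  by move=> yg; rewrite inE (fE _ _ yg) ffg /A fg0 eqxx.
have O_else y : y \notin K -> y - f g \notin K -> (y \in O) = (y - f y \in P).
  move=> yK yg; rewrite inE /A; case: eqP => [fy0|_].
    by case/negP: yK; rewrite -(subr0 y) -fy0.
  by case: eqP => // fyg; case/negP: yg; rewrite -fyg.
have aO : a \in O by rewrite O_K // inE subrr mem0_group orbT.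
have bO : b + f g \in O.
  by rewrite O_g ?addrK // inE subrr mem0_group orbT.
apply: (not_PT_property (tiling_pair_cosets fK fE TK tA)).
- move=> /periodic_prime[d d_pr]; rewrite -/O => dO.
  (* Omega is invariant under [r2] outside K, but [a] is in Omega while
     [a + r2] is not. *)
  have dK : d \in K.
    have R2O y : y \notin K -> y \in O -> y + r2 \in O.
      move=> yK; have r2K : r2 \in K by rewrite PK.
      have [yg|yg] := boolP (y - f g \in K).
        rewrite !O_g //; last by rewrite addrAC memDl_group.
        rewrite !inE [y + r2 - _]addrAC (@memDl_group _ P r2) //.
        by rewrite [_ + r2 - b]addrAC !(@memDl_group _ R2 r2).
      have fyr : f (y + r2) = f y by apply: fE; rewrite addrAC subrr add0r.
      have yr2K : y + r2 \notin K by rewrite memDl_group.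
      rewrite (O_else _ yK yg) (O_else _ yr2K); last by rewrite addrAC memDl_group.
      by rewrite fyr [y + r2 - _]addrAC (memDl_group _ r2P).
    apply/negPn/negP => dK.
    have adK : a + d \notin K by rewrite memDr_group.
    have := R2O _ adK; rewrite dO aO addrAC dO => /(_ isT).
    rewrite O_K; last by rewrite memD_group // PK //.
    rewrite inE (memDl_group _ r2P) (negbTE aP) /=.
    rewrite addrAC subrr add0r => /triv/(_ r2R) r2E.
    by rewrite r2E eqxx in r20.
  have dP := KP d dK d_pr.
  (* As d is in P and a is not, a + d is outside P and can belong to A1 only through R1 + a. The
     same holds for b and R2. *)
  have dR1 : d \in R1.
    have := dO a; rewrite aO O_K ?memD_group // inE (memDl_group _ dP) (negbTE aP) /=.
    by rewrite addrAC subrr add0r.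
  have dR2 : d \in R2.
    have := dO (b + f g); rewrite bO O_g; last by rewrite addrAC addrK memD_group.
    by rewrite addrAC addrK inE (memDl_group _ dP) (negbTE bP) /= addrAC subrr add0r.
  by move: (prime_order_neq0 d_pr); rewrite (triv d) ?eqxx.
- move=> h h_pr; rewrite -/O; have [hK|hK] := boolP (h \in K); last first.
    have dP := fP h h_pr hK; have [u [v [uR vR dE]]] := span _ dP.
    (* Wanted: w in A1, and w + h in the piece over the coset of h, be it A2 or P. The R2 component
       r2 of w keeps it out of R1; after adding h - f h = u + v the R1 component is r1, which keeps
       the sum out of R2. *)
    have [w [wP wR1 wdR2]] : exists w, [/\ w \in P, w \notin R1 & w + (h - f h) \notin R2].
      exists (r1 - u + r2); split.
      - by rewrite memD_group // (subsetP R1P) ?memB_group.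
      - rewrite memDr_group ?memB_group //.
        by apply/negP => /triv/(_ r2R) r2E; rewrite r2E eqxx in r20.
      - rewrite dE addrACA subrK memDl_group ?memD_group //.
        by apply/negP => /(triv _ r1R) r1E; rewrite r1E eqxx in r10.
    have wK := PK w wP; have fw : f (w + h) = f h by apply: fE; rewrite addrK.
    exists (w + h), w; split; last by rewrite addrAC subrr add0r.
      have [hg|hg] := boolP (h - f g \in K); last first.
        by rewrite O_else ?fw -?addrA ?(memDr_group _ wK) // memD_group.
      have fh : f h = f g.
        by apply: fE; rewrite -(subrK (f g) h) -addrA memD_group // memBC_group.
      by rewrite O_g -addrA ?(memDr_group _ wK) // -fh inE wdR2 (memD_group wP dP).
    by rewrite O_K // inE wP wR1.
  have hP := KP h hK h_pr; have [hR1|hR1] := boolP (h \in R1).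
    exists (a + h), a; split=> //; last by rewrite addrAC subrr add0r.
    by rewrite O_K ?memD_group // inE addrAC subrr add0r hR1 orbT.
  have [hR2|hR2] := boolP (h \in R2).
    exists (b + h + f g), (b + f g); split=> //; last first.
      by rewrite [b + h]addrC -[h + b + _]addrA addrK.
    rewrite O_g addrK ?memD_group // inE.
    by rewrite [b + h - b]addrAC subrr add0r hR2 orbT.
  have [h2|h2] := eqVneq #[h]%g 2.
    have [g' g'K g'g] := third h hP h2 hR1 hR2.
    (* The coset of g' carries P, so it contributes both f g' and f g' + h to Omega. *)
    have fg'K : f g' \notin K.
      by apply: contra g'K => fgK'; rewrite -(subrK (f g') g') memD_group.
    have fg'g : f g' - f g \notin K.
      apply: contra g'g => fgK'; rewrite -(subrK (f g') g') -addrA memD_group //.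
      by rewrite -(subrK (f g) (f g')) -addrA memD_group // memBC_group.
    have ffg' : f (f g') = f g' by apply: fE; rewrite memBC_group.
    exists (f g' + h), (f g'); split; last by rewrite addrAC subrr add0r.
      have fh : f (f g' + h) = f g'.
        by rewrite -[RHS]ffg'; apply: fE; rewrite addrAC subrr add0r.
      rewrite O_else; first by rewrite fh addrAC subrr add0r.
        by rewrite (memDl_group _ hK).
      by rewrite addrAC (memDl_group _ hK).
    by rewrite O_else // ffg' subrr mem0_group.
  (* Here the order of h is an odd prime, so 2 h generates the same subgroup as h; both 2 h and h
     lie in P minus R1. *)
  have h2R1 : h *+ 2 \notin R1.
    apply: contra hR1 => h2R1.
    apply: (@memMn_coprime _ _ _ 2 #[h]%g) => //; last first.
      by rewrite mulrn_order mem0_group.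
    by rewrite prime_coprime // dvdn_prime2 // eq_sym.
  exists (h *+ 2), h; rewrite mulr2n addrK; split=> //.
    by rewrite -mulr2n O_K ?memMn_group // inE memMn_group ?h2R1.
  by rewrite O_K // inE hP hR1.
Qed.

(** * Independent generators and arithmetic of their coefficients *)

Lemma mem_cycle_mulrn (G : finZmodType) (c x : G) :
  reflect (exists i, x = c *+ i) (x \in <[c]>%g).
Proof. by apply: (iffP (@cycleP _ c x)) => -[i ->]; exists i. Qed.

Lemma mem_joing_add (G : finZmodType) (H1 H2 : {group G}) (x : G) :
  reflect (exists u v, [/\ u \in H1, v \in H2 & x = u + v])
    (x \in (H1 <*> H2)%G).
Proof.
have cH : H2 \subset 'C(H1)%g.
  by rewrite (sub_abelian_cent2 (FinRing.zmod_abelian [set: G])) ?subsetT.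
rewrite /= cent_joinEr //; apply: (iffP mulsgP) => [[u v uH vH ->]|[u [v [uH vH ->]]]].
  by exists u, v.
by exists u v.
Qed.

(** Equivalently, (i, j) -> i a + j b is a well-defined embedding of Z_m x Z_n into G. *)
Definition independent (G : finZmodType) (a b : G) (m n : nat) :=
  [/\ a *+ m = 0, b *+ n = 0
    & forall i j, a *+ i + b *+ j = 0 -> (m %| i)%N && (n %| j)%N].

Lemma independentC (G : finZmodType) (a b : G) m n :
  independent a b m n -> independent b a n m.
Proof. by case=> am bn ab; split=> // i j; rewrite addrC => /ab; rewrite andbC. Qed.

Lemma mulrn_eq_mod (G : finZmodType) (c : G) k i j :
  c *+ k = 0 -> i = j %[mod k] -> c *+ i = c *+ j.
Proof.
move=> ck ij; rewrite (divn_eq i k) (divn_eq j k) ij.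
by rewrite !mulrnDr !(mulnC _ k) !mulrnA ck !mul0rn.
Qed.

Lemma independent_inj (G : finZmodType) (a b : G) m n i j i' j' :
  (0 < m)%N -> (0 < n)%N -> independent a b m n ->
  a *+ i + b *+ j = a *+ i' + b *+ j' -> i = i' %[mod m] /\ j = j' %[mod n].
Proof.
move=> m0 n0 [am bn ab] E.
(* Subtraction of naturals truncates; adding the multiple k v first prevents this and changes
   nothing modulo k. *)
have le k u v : (0 < k)%N -> (v <= k * v + u)%N.
  by move=> k0; rewrite (leq_trans (leq_pmull v k0)) ?leq_addr.
have sub (c : G) k u v : (0 < k)%N -> c *+ k = 0 ->
    c *+ (k * v + u - v) = c *+ u - c *+ v.
  by move=> k0 ck; rewrite mulrnBr ?le // mulrnDr mulrnA ck mul0rn add0r.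
have /andP[] : (m %| m * i' + i - i')%N && (n %| n * j' + j - j')%N.
  by apply: ab; rewrite !sub // addrACA -opprD E subrr.
by rewrite -!eqn_mod_dvd ?le // !(mulnC _ i', mulnC _ j') !modnMDl => /eqP ? /eqP.
Qed.

(** Otherwise m^2 would divide the prime r. Applied to the coefficients of an element of prime order
    r in K, it puts that element in P. *)
Lemma prime_sqr_dvdn_mul m r i :
  prime m -> prime r -> (m ^ 2 %| i * r)%N -> (m %| i)%N.
Proof.
move=> m_pr r_pr mir; have [//|mi] := boolP (m %| i)%N.
have co : coprime (m ^ 2) i by rewrite coprimeXl // prime_coprime.
rewrite (Gauss_dvdr _ co) in mir.
have mr : m = r.
  by apply/eqP; rewrite -dvdn_prime2 // (dvdn_trans _ mir) // expnS dvdn_mulr.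
move: mir; rewrite -mr => /dvdn_leq; rewrite prime_gt0 // => /(_ isT).
by rewrite leqNgt expnS expn1 ltn_Pmull // ?prime_gt1 ?prime_gt0.
Qed.

(** * The complement T, its shifts by a and b, and the resulting tiling *)

Definition box (G : finZmodType) (a b : G) (m n : nat) : {set G} :=
  [set x | [exists i : 'I_m, exists j : 'I_n, x == a *+ i + b *+ j]].

Lemma boxP (G : finZmodType) (a b : G) m n (x : G) :
  reflect (exists i j, [/\ (i < m)%N, (j < n)%N & x = a *+ i + b *+ j])
    (x \in box a b m n).
Proof.
rewrite inE; apply: (iffP existsP) => [[i /existsP[j /eqP ->]]|[i [j [im jn ->]]]].
  by exists i, j; split.
by exists (Ordinal im); apply/existsP; exists (Ordinal jn).
Qed.

Lemma boxC (G : finZmodType) (a b : G) m n : box a b m n = box b a n m.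
Proof.
by apply/setP => x; apply/boxP/boxP => -[i [j [im jn ->]]]; exists j, i; rewrite addrC.
Qed.

(** Adding a leaves the box only from i = m - 1; the coefficient then wraps to 0 with carry m a. *)
Lemma box_shift (G : finZmodType) (a b : G) m n t :
  (0 < m)%N -> t \in box a b m n ->
  exists r t', [/\ r \in <[a *+ m]>%G, t' \in box a b m n & a + t = r + t'].
Proof.
move=> m0 /boxP[i [j [im jn ->]]]; have [im'|im'] := ltnP i.+1 m.
  exists 0, (a *+ i.+1 + b *+ j); rewrite mem0_group add0r addrA -mulrS; split=> //.
  by apply/boxP; exists i.+1, j.
exists (a *+ m), (b *+ j); split; first exact: cycle_id.
  by apply/boxP; exists 0, j; rewrite mulr0n add0r.
by rewrite addrA -mulrS; congr (a *+ _ + _); apply/eqP; rewrite eqn_leq im im'.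
Qed.

Lemma box_unshift (G : finZmodType) (a b : G) m n t :
  t \in box a b m n ->
  exists r t', [/\ r \in <[a *+ m]>%G, t' \in box a b m n & t = a + (r + t')].
Proof.
move=> /boxP[[|i] [j [im jn ->]]]; last first.
  exists 0, (a *+ i + b *+ j); rewrite mem0_group add0r addrA -mulrS; split=> //.
  by apply/boxP; exists i, j; rewrite ltnW.
exists (- (a *+ m)), (a *+ m.-1 + b *+ j); split.
- by rewrite memN_group cycle_id.
- by apply/boxP; exists m.-1, j; rewrite ltn_predL.
- by rewrite addrCA [a + (_ + _)]addrA -mulrS prednK // addKr mulr0n add0r.
Qed.

Lemma not_PT_property_grid (G : finZmodType) (K : {group G}) (a b g : G) m n :
  prime m -> prime n -> independent a b (m ^ 2) (n ^ 2) ->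
  (forall x, x \in K <-> exists i j, x = a *+ i + b *+ j) -> g \notin K ->
  (m = 2 -> n = 2 -> exists2 g', g' \notin K & g' - g \notin K) ->
  ~ PT_property G.
Proof.
move=> m_pr n_pr ind KE gK third.
have [m0 n0] := (prime_gt0 m_pr, prime_gt0 n_pr).
have [m20 n20] : (0 < m ^ 2)%N /\ (0 < n ^ 2)%N by rewrite !expn_gt0 m0 n0.
have [am bn ab] := ind; have inj := independent_inj m20 n20 ind.
pose R1 := <[a *+ m]>%G; pose R2 := <[b *+ n]>%G; pose P := (R1 <*> R2)%G.
have ndvd k : prime k -> (k ^ 2 %| k)%N = false.
  move=> k_pr; apply/negbTE/negP => /dvdn_leq; rewrite prime_gt0 // => /(_ isT).
  by rewrite leqNgt expnS expn1 ltn_Pmull // ?prime_gt1 ?prime_gt0.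
have PE x : x \in P <-> exists i j, x = a *+ (m * i) + b *+ (n * j).
  split=> [/mem_joing_add[_ [_ [/mem_cycle_mulrn[i ->] /mem_cycle_mulrn[j ->] ->]]]|].
    by exists i, j; rewrite !mulrnA.
  case=> i [j ->]; apply/mem_joing_add; exists (a *+ (m * i)), (b *+ (n * j)).
  by split=> //; apply/mem_cycle_mulrn; [exists i|exists j]; rewrite mulrnA.
have aK : a \in K by apply/KE; exists 1%N, 0; rewrite mulr0n addr0.
have bK : b \in K by apply/KE; exists 0, 1%N; rewrite mulr0n add0r.
have R1P : R1 \subset P by exact: joing_subl.
have R2P : R2 \subset P by exact: joing_subr.
have PK x : x \in P -> x \in K by move=> /PE[i [j ->]]; apply/KE; eexists; eexists.
have TK t : t \in box a b m n -> t \in K.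
  by case/boxP=> i [j [_ _ ->]]; apply/KE; exists i, j.
apply: (@not_PT_property_switch G K P R1 R2 (box a b m n) a b g (a *+ m) (b *+ n)) => //.
- exact/subsetP.
(* Euclidean division of the coefficients by m and n: the multiples of m and n go to P, the
   remainders to T. *)
- split=> [x t xP tT|k /KE[i [j ->]]|x t x' t'].
  + exact: memD_group (PK _ xP) (TK _ tT).
  + exists (a *+ (m * (i %/ m)) + b *+ (n * (j %/ n))), (a *+ (i %% m) + b *+ (j %% n)).
    split; first by apply/PE; eexists; eexists.
      by apply/boxP; exists (i %% m)%N, (j %% n)%N; rewrite !ltn_mod.
    by rewrite addrACA -!mulrnDr ![(_ * (_ %/ _))%N]mulnC -!divn_eq.
  + move=> /PE[i [j ->]] /boxP[u [v [um vn ->]]] /PE[i' [j' ->]].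
    move=> /boxP[u' [v' [u'm v'n ->]]] E.
    move: (E); rewrite [LHS]addrACA [RHS]addrACA -!mulrnDr => /inj[].
    move=> /(congr1 (modn^~ m)) /= Eu /(congr1 (modn^~ n)) /= Ev.
    rewrite !modn_dvdm ?expnS ?dvdn_mulr // !(mulnC m, mulnC n) !modnMDl in Eu Ev.
    rewrite !modn_small // in Eu Ev; rewrite Eu Ev in E.
    exact: addIr E.
- move=> x /KE[i [j ->]] x_pr; apply/PE.
  have := mulrn_order (a *+ i + b *+ j); move: #[_]%g x_pr => r r_pr.
  rewrite mulrnDl -!mulrnA => /ab/andP[].
  move=> /(prime_sqr_dvdn_mul m_pr r_pr)/dvdnP[i' ->].
  move=> /(prime_sqr_dvdn_mul n_pr r_pr)/dvdnP[j' ->].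
  by exists i', j'; rewrite !(mulnC _ m, mulnC _ n).
- by move=> x /mem_joing_add.
- move=> x /mem_cycle_mulrn[i ->] /mem_cycle_mulrn[j]; rewrite -!mulrnA => E.
  have [] := inj (m * i)%N 0 0 (n * j)%N; first by rewrite !mulr0n addr0 add0r.
  by move=> /(mulrn_eq_mod am).
- exact: cycle_id.
- by apply/eqP => E; have := ab m 0; rewrite E mulr0n addr0 ndvd // => /(_ erefl).
- exact: cycle_id.
- by apply/eqP => E; have := ab 0 n; rewrite E mulr0n addr0 ndvd // andbF => /(_ erefl).
(* If a were in P, its coefficient 1 would be a multiple of m modulo m^2, hence 0 modulo m. *)
- apply/negP => /PE[i [j]]; rewrite -{1}[a]mulr1n -[a *+ 1]addr0 -(mulr0n b).
  move=> /inj[/(congr1 (modn^~ m)) /= + _].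
  rewrite !modn_dvdm ?expnS ?dvdn_mulr // modnMr modn_small ?prime_gt1 //.
- apply/negP => /PE[i [j]]; rewrite -{1}[b]mulr1n -[b *+ 1]add0r -(mulr0n a).
  move=> /inj[_ /(congr1 (modn^~ n)) /=].
  rewrite !modn_dvdm ?expnS ?dvdn_mulr // modnMr modn_small ?prime_gt1 //.
- by move=> t; apply: box_shift.
- by move=> t; apply: box_unshift.
- by move=> t; rewrite boxC; apply: box_shift.
- by move=> t; rewrite boxC; apply: box_unshift.
- move=> h /PE[i [j ->]] h2.
  have := mulrn_order (a *+ (m * i) + b *+ (n * j)); rewrite h2 mulrnDl -!mulrnA.
  move=> /ab/andP[m2 n2] hR1 hR2.
  (* For an odd prime k, a multiple of k c killed by 2 is zero. So if m or n is odd, an h of order 2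
     loses one component and lies in R2 or R1. *)
  have two (c : G) k e : prime k -> k <> 2 -> c *+ (k ^ 2) = 0 ->
      (k ^ 2 %| k * e * 2)%N -> c *+ (k * e) = 0.
    move=> k_pr k2 ck; rewrite expnS expn1 -mulnA dvdn_pmul2l ?prime_gt0 //.
    rewrite Gauss_dvdl; last by rewrite prime_coprime // dvdn_prime2 //; apply/eqP.
    by move=> /dvdnP[e' ->]; rewrite mulnCA mulnn mulnC mulrnA ck mul0rn.
  have [m2E|m2N] := m =P 2; last first.
    case/negP: hR2; apply/mem_cycle_mulrn; exists j.
    by rewrite (two a) // add0r mulrnA.
  have [n2E|n2N] := n =P 2; last first.
    case/negP: hR1; apply/mem_cycle_mulrn; exists i.
    by rewrite (two b) // addr0 mulrnA.
  exact: third.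
Qed.

(** * Isomorphisms with products of cyclic groups, and the index 2 case *)

Lemma isog_of_morph (A : finGroupType) (G : finZmodType) (f : A -> G) :
  {morph f : x y / (x * y)%g >-> x + y} -> (forall x, f x = 0 -> x = 1%g) ->
  (forall y, exists x, f x = y) -> [set: G] \isog [set: A].
Proof.
move=> fM fker fsurj; rewrite isog_sym; apply/isogP.
have fMg : {in [set: A] &, {morph f : x y / (x * y)%g}} by move=> x y _ _; exact: fM.
exists (Morphism fMg).
  apply/subsetP => x /morphpreP[_ /set1P fx]; apply/set1P; exact: fker.
apply/setP => y; rewrite inE; have [x <-] := fsurj y.
by apply/morphimP; exists x; rewrite ?inE.
Qed.

Lemma morph_of_isog (A : finGroupType) (G : finZmodType) (K : {group G}) :
  K \isog [set: A] -> exists f : A -> G,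
    [/\ {morph f : x y / (x * y)%g >-> x + y}, injective f
      & forall x, x \in K <-> exists y, x = f y].
Proof.
rewrite isog_sym => /isogP[f /injmP finj fK]; exists f; split.
- by move=> x y; apply: (morphM f); rewrite inE.
- by move=> x y; apply: finj; rewrite inE.
- move=> x; rewrite -fK; split=> [/morphimP[y _ _ ->]|[y ->]]; first by exists y.
  by apply/morphimP; exists y; rewrite ?inE.
Qed.

Lemma Zp_mulrnD (G : finZmodType) (c : G) m (u v : 'Z_m) :
  (1 < m)%N -> c *+ m = 0 -> c *+ (u + v)%R = c *+ u + c *+ v.
Proof.
move=> m1 cm; rewrite -mulrnDr; apply: (mulrn_eq_mod cm).
(* The modulus built into ['Z_m] is [(Zp_trunc m).+2], which equals m because m > 1. *)
have -> : nat_of_ord (u + v)%R = ((u + v) %% m)%N by congr (_ %% _)%N; exact: Zp_cast.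
by rewrite modn_mod.
Qed.

Lemma Zp_dvdn_eq0 m (u : 'Z_m) : (1 < m)%N -> (m %| u)%N -> u = 0.
Proof.
move=> m1; have um : (u < m)%N by rewrite -[X in (_ < X)%N](Zp_cast m1).
by rewrite /dvdn modn_small // => /eqP u0; apply/val_inj.
Qed.

Lemma isog_Zp2 (G : finZmodType) (a b : G) m n :
  (1 < m)%N -> (1 < n)%N -> independent a b m n ->
  (forall x, exists i j, x = a *+ i + b *+ j) ->
  [set: G] \isog [set: 'Z_m * 'Z_n].
Proof.
move=> m1 n1 [am bn ab] span.
pose f (x : 'Z_m * 'Z_n) := a *+ x.1 + b *+ x.2.
apply: (@isog_of_morph _ _ f) => [x y|[u v] /ab/andP[]|x].
- by rewrite /f /= !Zp_mulrnD // [RHS]addrACA.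
- by move=> /(Zp_dvdn_eq0 m1) /= -> /(Zp_dvdn_eq0 n1) /= ->.
- have [i [j ->]] := span x; exists (i%:R, j%:R); rewrite /f /= !val_Zp_nat //.
  by congr (_ + _); [apply: (mulrn_eq_mod am)|apply: (mulrn_eq_mod bn)]; rewrite modn_mod.
Qed.

Lemma isog_Zp3 (G : finZmodType) (a b c : G) m n l :
  (1 < m)%N -> (1 < n)%N -> (1 < l)%N -> a *+ m = 0 -> b *+ n = 0 -> c *+ l = 0 ->
  (forall i j k, a *+ i + b *+ j + c *+ k = 0 ->
     [/\ (m %| i)%N, (n %| j)%N & (l %| k)%N]) ->
  (forall x, exists i j k, x = a *+ i + b *+ j + c *+ k) ->
  [set: G] \isog [set: 'Z_m * 'Z_n * 'Z_l].
Proof.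
move=> m1 n1 l1 am bn cl abc span.
pose f (x : 'Z_m * 'Z_n * 'Z_l) := a *+ x.1.1 + b *+ x.1.2 + c *+ x.2.
apply: (@isog_of_morph _ _ f) => [x y|[[u v] w] /abc[]|x].
- by rewrite /f /= !Zp_mulrnD // [RHS]addrACA; congr (_ + _); rewrite [RHS]addrACA.
- move=> /(Zp_dvdn_eq0 m1) /= -> /(Zp_dvdn_eq0 n1) /= ->.
  by move=> /(Zp_dvdn_eq0 l1) /= ->.
- have [i [j [k ->]]] := span x; exists (i%:R, j%:R, k%:R); rewrite /f /= !val_Zp_nat //.
  by congr (_ + _ + _); [apply: (mulrn_eq_mod am)|apply: (mulrn_eq_mod bn)
    |apply: (mulrn_eq_mod cl)]; rewrite modn_mod.
Qed.

(** As i is invertible modulo 4, a = i (2 g - j b) is recovered from g and b, which become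
    independent generators of orders 8 and 4. The coefficient -1 of b is written 3. *)
Lemma isog_Z8_Z4 (G : finZmodType) (K : {group G}) (a b g : G) i j :
  independent a b 4 4 -> (forall x, x \in K <-> exists i j, x = a *+ i + b *+ j) ->
  g \notin K -> (forall y, y \in K \/ y - g \in K) ->
  g *+ 2 = a *+ i + b *+ j -> odd i -> [set: G] \isog [set: 'Z_8 * 'Z_4].
Proof.
move=> [a4 b4 ab] KE gK cosets g2 i_odd.
have g2K : g *+ 2 \in K by apply/KE; exists i, j.
have gb u v : g *+ (2 * u) + b *+ v = a *+ (i * u) + b *+ (j * u + v).
  by rewrite mulrnA g2 mulrnDl mulrnDr !mulrnA addrA.
have eq_a u v : u = v %[mod 4] -> a *+ u = a *+ v by exact: mulrn_eq_mod.
have eq_b u v : u = v %[mod 4] -> b *+ u = b *+ v by exact: mulrn_eq_mod.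
(* i^2 = 1 modulo 4 *)
have aE : a = g *+ (2 * i) + b *+ (3 * (j * i)).
  rewrite gb -mulSn (eq_b _ 0%N); last by rewrite modnMr mod0n.
  rewrite mulr0n addr0 -{1}[a]mulr1n; apply: eq_a.
  have : (i %% 4 == 1)%N || (i %% 4 == 3)%N.
    have := odd_mod i (erefl : odd 4 = false); rewrite i_odd.
    by have := ltn_pmod i (isT : 0 < 4)%N; case: (i %% 4)%N => [|[|[|[|]]]].
  by rewrite -modnMm => /orP[] /eqP ->.
apply: (@isog_Zp2 _ g b) => //; first split=> //.
- by rewrite -[8%N]/(2 * 4)%N mulrnA g2 mulrnDl mulrnAC a4 mulrnAC b4 !mul0rn addr0.
- move=> u v E.
  (* If u were odd, the coprime multiples 2 g and u g would both lie in K, and so would g. *)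
  have : (2 %| u)%N.
    rewrite dvdn2; apply: contra gK => u_odd; apply: (@memMn_coprime _ _ _ 2 u) => //.
    - by rewrite coprime2n.
    - have bK : b *+ v \in K by apply/KE; exists 0, v; rewrite mulr0n add0r.
      by rewrite -(memDl_group _ bK) E mem0_group.
  case/dvdnP=> w uE; move: E; rewrite uE (mulnC w) gb => /ab/andP[].
  rewrite Gauss_dvdr; last by rewrite (coprimeXl 2 (_ : coprime 2 i)) ?coprime2n.
  move=> w4; rewrite (dvdn_addr _ (dvdn_mull j w4)) => ->.
  by rewrite (@dvdn_pmul2l 2 4 w) // w4.
have spanK x : x \in K -> exists u v, x = g *+ u + b *+ v.
  case/KE=> u [v ->]; exists (2 * i * u)%N, (3 * (j * i) * u + v)%N.
  by rewrite {1}aE mulrnDl -!mulrnA mulrnDr addrA.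
move=> x; have [/spanK//|/spanK[u [v xE]]] := cosets x.
by exists u.+1, v; rewrite mulrSr addrAC -xE subrK.
Qed.

(** Index 2 puts 2 g in K. If one of its coefficients is odd, g has order 8; if both are even,
    subtracting half of 2 g from g gives an element of order 2 outside K, and K splits off. *)
Lemma isog_index2 (G : finZmodType) (K : {group G}) (a b g : G) :
  independent a b 4 4 -> (forall x, x \in K <-> exists i j, x = a *+ i + b *+ j) ->
  g \notin K -> (forall y, y \in K \/ y - g \in K) ->
  [set: G] \isog [set: 'Z_8 * 'Z_4] \/ [set: G] \isog [set: 'Z_4 * 'Z_4 * 'Z_2].
Proof.
move=> ind KE gK cosets.
have [|] := cosets (g *+ 2); last by rewrite mulr2n addrK (negbTE gK).
case/KE=> i [j g2]; have [i_odd|i_even] := boolP (odd i).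
  by left; apply: isog_Z8_Z4 g2 i_odd.
have [j_odd|j_even] := boolP (odd j).
  left; apply: (isog_Z8_Z4 (independentC ind) _ gK cosets _ j_odd).
    move=> x; split=> [/KE[u [v ->]]|[u [v ->]]].
      by exists v, u; rewrite addrC.
    by rewrite addrC; apply/KE; exists v, u.
  by rewrite g2 addrC.
right; have [a4 b4 ab] := ind.
pose k := a *+ i./2 + b *+ j./2; have kK : k \in K by apply/KE; exists i./2, j./2.
have c2 : (g - k) *+ 2 = 0.
  rewrite mulrnBl g2 mulrnDl -!mulrnA !muln2.
  by rewrite !even_halfK // subrr.
have cK : g - k \notin K by rewrite memDl_group ?memN_group.
apply: (@isog_Zp3 _ a b (g - k)) => // [u v w E|x].
  have w2 : (2 %| w)%N.
    rewrite dvdn2; apply: contra cK => w_odd; apply: (@memMn_coprime _ _ _ 2 w) => //.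
    - by rewrite coprime2n.
    - by rewrite c2 mem0_group.
    - have abK : a *+ u + b *+ v \in K by apply/KE; exists u, v.
      by rewrite -(memDr_group _ abK) E mem0_group.
  move: E; rewrite (mulrn_eq_mod (j := 0) c2); last by rewrite (eqP w2).
  by rewrite mulr0n addr0 => /ab/andP[].
have [/KE[u [v ->]]|xg] := cosets x; first by exists u, v, 0; rewrite mulr0n addr0.
have /KE[u [v xE]] : x - g + k \in K by rewrite memD_group.
by exists u, v, 1%N; rewrite -xE mulr1n addrACA subrK subrr addr0.
Qed.

(** * Generators read off from the isomorphism type of K, and the conclusion *)

Lemma independent_Zp2 (G : finZmodType) (K : {group G}) m n :
  (1 < m)%N -> (1 < n)%N -> K \isog [set: 'Z_m * 'Z_n] ->
  exists a b : G, independent a b m n /\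
    forall x, x \in K <-> exists i j, x = a *+ i + b *+ j.
Proof.
move=> m1 n1 /morph_of_isog[f [fM finj KE]].
have f1 : f 1%g = 0 by apply: (addIr (f 1%g)); rewrite -fM mulg1 add0r.
have fX x i : f (x ^+ i)%g = f x *+ i.
  by elim: i => [|i IH]; rewrite ?f1 // expgS fM IH mulrS.
have fE i j : f (1, 0) *+ i + f (0, 1) *+ j = f (i%:R, j%:R).
  have pX (u : 'Z_m) (v : 'Z_n) k : ((u, v) ^+ k)%g = (u *+ k, v *+ k).
    by elim: k => // k IH; rewrite expgS IH !mulrS.
  rewrite -!fX -fM !pX !mul0rn; congr f.
  by transitivity (i%:R + 0 : 'Z_m, 0 + j%:R : 'Z_n); last by rewrite addr0 add0r.
have f_mod i j : f (i%:R, j%:R) = 0 -> (m %| i)%N && (n %| j)%N.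
  rewrite -f1 => /finj[/(congr1 val) + /(congr1 val)].
  by rewrite /= !val_Zp_nat // /dvdn => -> ->.
exists (f (1, 0)), (f (0, 1)); split; first split.
- have := fE m 0; rewrite mulr0n addr0 => ->; rewrite -f1; congr f.
  by congr pair; apply/val_inj; rewrite /= val_Zp_nat // modnn.
- have := fE 0 n; rewrite mulr0n add0r => ->; rewrite -f1; congr f.
  by congr pair; apply/val_inj; rewrite /= val_Zp_nat // modnn.
- by move=> i j; rewrite fE => /f_mod.
- move=> x; split=> [/KE[[u v] ->]|[i [j ->]]]; last by apply/KE; rewrite fE; eexists.
  by exists u, v; rewrite fE !natr_Zp.
Qed.

(** Chinese remaindering: for a generator c of K, the elements n c and m c have orders m and n and
    together generate K. *)
Lemma independent_Zp_coprime (G : finZmodType) (K : {group G}) m n :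
  (1 < m)%N -> (1 < n)%N -> coprime m n -> K \isog [set: 'Z_(m * n)] ->
  exists a b : G, independent a b m n /\
    forall x, x \in K <-> exists i j, x = a *+ i + b *+ j.
Proof.
move=> m1 n1 co /morph_of_isog[f [fM finj KE]].
have f1 : f 1%g = 0 by apply: (addIr (f 1%g)); rewrite -fM mulg1 add0r.
have fX x i : f (x ^+ i)%g = f x *+ i.
  by elim: i => [|i IH]; rewrite ?f1 // expgS fM IH mulrS.
have mn1 : (1 < m * n)%N by rewrite -[1%N]muln1 ltn_mul.
(* [1%R] is the ring unit, a generator of the cyclic group, whereas [1%g] is its zero. *)
pose c := f 1%R.
have cE k : c *+ k = f k%:R by rewrite -fX zmodXgE.
have c_mod k : c *+ k = 0 -> (m * n %| k)%N.
  rewrite cE -f1 => /finj/(congr1 val); rewrite /= val_Zp_nat // => kE.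
  by rewrite /dvdn kE.
have c0 : c *+ (m * n) = 0.
  by rewrite cE -f1; congr f; apply/val_inj; rewrite /= val_Zp_nat // modnn.
exists (c *+ n), (c *+ m); split; first split.
- by rewrite -mulrnA mulnC.
- by rewrite -mulrnA.
- move=> i j; rewrite -!mulrnA -mulrnDr => /c_mod mnE.
  have := dvdn_trans (dvdn_mulr n (dvdnn m)) mnE.
  rewrite (dvdn_addl _ (dvdn_mulr j (dvdnn m))) Gauss_dvdr // => ->.
  have := dvdn_trans (dvdn_mull m (dvdnn n)) mnE.
  by rewrite (dvdn_addr _ (dvdn_mulr i (dvdnn n))) Gauss_dvdr // coprime_sym.
- move=> x; split=> [/KE[y ->]|[i [j ->]]]; last first.
    by apply/KE; rewrite -!mulrnA -mulrnDr cE; eexists.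
  have n0 : (0 < n)%N by exact: ltnW.
  case: (egcdnP m n0) => u v E _; rewrite gcdnC (eqP co) in E.
  (* From u n = v m + 1 one gets k = n (k u) - m (v k); the factor n - 1 replaces -1 modulo n to
     stay in the naturals. *)
  have bezout k : (n * (k * u) + m * (v * k * n.-1) = v * k * (m * n) + k)%N.
    rewrite mulnCA (mulnC n) E mulnDr muln1 addnAC; congr (_ + _)%N.
    rewrite -[in RHS](prednK n0) mulnS mulnDr.
    by congr (_ + _)%N; [rewrite mulnA (mulnC k)|rewrite mulnCA].
  exists (y * u)%N, (v * y * n.-1)%N.
  rewrite -{1}[y]natr_Zp -cE -!mulrnA -mulrnDr bezout.
  by apply: (mulrn_eq_mod c0); rewrite modnMDl.
Qed.

Theorem theorem1p4 (p q : nat) (G : finZmodType)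
  (p_prime : prime p) (q_prime : prime q) (p_neq_q : p <> q) (q_odd : odd q)
  (subG : has_proper_subgroup_isog G [set: 'Z_(p ^ 2) * 'Z_(p ^ 2)]
       \/ has_proper_subgroup_isog G [set: 'Z_(p ^ 2 * q ^ 2)])
  (notG1 : ~ [set: G] \isog [set: 'Z_(p ^ 2) * 'Z_(p ^ 2) * 'Z_2])
  (notG2 : ~ [set: G] \isog [set: 'Z_(2 * p ^ 2) * 'Z_(p ^ 2)])
  (notG3 : ~ [set: G] \isog [set: 'Z_9 * 'Z_9 * 'Z_3])
  (notG4 : ~ [set: G] \isog [set: 'Z_4 * 'Z_4 * ('Z_2 * 'Z_2)])
  (notG5 : ~ [set: G] \isog [set: 'Z_(4 * q ^ 2) * 'Z_2]) :
  ~ PT_property G.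
Proof.
have sqr_gt1 r : prime r -> (1 < r ^ 2)%N.
  by move=> r_pr; rewrite -(exp1n 2) ltn_exp2r // prime_gt1.
case: subG => -[K /properP[_ [g _ gK]]].
  move=> /independent_Zp2[||a [b [ind KE]]]; rewrite ?sqr_gt1 //.
  apply: (not_PT_property_grid p_prime p_prime ind KE gK) => p2 _.
  have [/existsP[g' /andP[? ?]]|no_third] :=
      boolP [exists g', (g' \notin K) && (g' - g \notin K)]; first by exists g'.
  (* Without a third coset K has index 2. As p = 2, G is then one of the first two excluded
     groups. *)
  have cosets y : y \in K \/ y - g \in K.
    apply/orP; apply: contraR no_third; rewrite negb_or => yP.
    by apply/existsP; exists y.
  by rewrite p2 in ind notG1 notG2; case: (isog_index2 ind KE gK cosets).
move=> /independent_Zp_coprime[|||a [b [ind KE]]]; rewrite ?sqr_gt1 //.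
  by rewrite coprimeXl // coprimeXr // prime_coprime // dvdn_prime2 //; apply/eqP.
(* A third coset is requested only if p = q = 2, which contradicts that p and q are distinct. *)
apply: (not_PT_property_grid p_prime q_prime ind KE gK) => p2 q2.
by case: p_neq_q; rewrite p2 q2.
Qed.
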